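(* Let $X$ be a set, let $m,n\ge 2$ be integers, and let $f,g\in\Omega_m(X)$. If $(X,f)$ is isotopic to $(X,g)$, then $(\Omega_n(X),\odot_f)$ is isotopic to $(\Omega_n(X),\odot_g)$.
   Context: For a set $Y$, $\Omega_m(Y)$ is the set of all $m$-ary operations $Y^m\to Y$. For $f\in\Omega_m(X)$, the $m$-ary operation $\odot_f$ on the set $\Omega_n(X)$ is defined by $\odot_f(h_1,\ldots,h_m)(\overline a):=f(h_1(\overline a),\ldots,h_m(\overline a))$ for all $h_1,\ldots,h_m\in\Omega_n(X)$ and $\overline a\in X^n$. For $F,G\in\Omega_m(Y)$, $(Y,F)$ is isotopic to $(Y,G)$ if there exist $m+1$ permutations (bijections) $\pi_1,\ldots,\pi_{m+1}$ of $Y$ such that $G(\pi_1(a_1),\ldots,\pi_m(a_m))=\pi_{m+1}(F(a_1,\ldots,a_m))$ for all $a_1,\ldots,a_m\in Y$. *)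

(* Defs.v *)
From mathcomp Require Import all_boot.

Set Implicit Arguments.
Unset Strict Implicit.
Unset Printing Implicit Defensive.

(* [Omega m Y] is the set of all m-ary operations Y^m -> Y. *)
Definition Omega (m : nat) (Y : Type) : Type := m.-tuple Y -> Y.

Definition odot (X : Type) (m n : nat) (f : Omega m X) : Omega m (Omega n X) :=
  fun (h : m.-tuple (Omega n X)) (a : n.-tuple X) =>
    f [tuple tnth h i a | i < m].

(* The m + 1 permutations are indexed from 0: the first m act on the arguments
   and the last one, [pi ord_max], acts on the value. *)
Definition isotopic (Y : Type) (m : nat) (F G : Omega m Y) : Prop :=
  exists pi : 'I_m.+1 -> Y -> Y,
    (forall i : 'I_m.+1, bijective (pi i)) /\
    (forall a : m.-tuple Y,
       G [tuple pi (widen_ord (leqnSn m) i) (tnth a i) | i < m]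
       = pi ord_max (F a)).

(* Main.v *)
Require Import Defs.
From mathcomp Require Import all_boot.
From Stdlib Require Import FunctionalExtensionality.

(** Post-composition with a permutation of [X] permutes [Omega n X] ([bij_postcomp]), and [odot]
    acts pointwise. So post-composing with each [pi i] lifts the isotopy: at a point [a], the
    required identity is the given one at the values of the [h_i] at [a]. *)

Lemma bij_postcomp (A B C : Type) (p : B -> C) :
  bijective p -> bijective (fun (h : A -> B) (a : A) => p (h a)).
Proof.
case=> q pK qK; exists (fun h a => q (h a)) => h;
  by apply: functional_extensionality => a; rewrite ?pK ?qK.
Qed.

Theorem lemma3p7 (X : Type) (m n : nat) (hm : 2 <= m) (hn : 2 <= n)
    (f g : Omega m X) :
  isotopic f g -> isotopic (odot (n := n) f) (odot (n := n) g).
Proof.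
case=> pi [pi_bij pi_iso].
exists (fun i (h : Omega n X) a => pi i (h a)); split=> [i|h].
  exact: bij_postcomp.
(* [pi_iso] is used at the tuple of values [tnth h i a]; only the two argument tuples of [g] remain
   to be compared. *)
apply: functional_extensionality => a; rewrite /odot -pi_iso.
by congr (g _); apply: eq_from_tnth => i; rewrite !tnth_mktuple.
Qed.
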